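(* Let $Z_1$ and $Z_2$ be tight multimatroids that align at a non-singular skew class $e=\{e_1,\ldots,e_q\}$. Let $U=U(Z_1\oplus_2 Z_2)$ and $U_2'=U(Z_2)-e$. Then \[ Q(Z_1\oplus_2 Z_2;\{x_u\}_{u\in U},t)=Q\big(Z_1;\{x_u\}_{u\in U(Z_1)},t\ \big|\ x_{e_i}=y_{e_i},\ i=1,\ldots,q\big),\] where $\{y_u\}_{u\in e}$ is the unique solution to the following system of linear equations in the ring $\mathbb Z[t,\{x_u\}_{u\in U_2'}]$: \begin{align*} Q(Z_2|e_1;\{x_u\}_{u\in U_2'},t)&=ty_{e_1}+y_{e_2}+\cdots+y_{e_q},\\ Q(Z_2|e_2;\{x_u\}_{u\in U_2'},t)&=y_{e_1}+ty_{e_2}+\cdots+y_{e_q},\\ &\ \,\vdots\\ Q(Z_2|e_q;\{x_u\}_{u\in U_2'},t)&=y_{e_1}+y_{e_2}+\cdots+ty_{e_q}. \end{align*}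
   Context: A carrier is a pair $(U,\Omega)$ where $U$ is a finite set (the ground set) and $\Omega$ is a partition of $U$ into non-empty blocks called skew classes. A skew pair is a pair of distinct elements of the same skew class. A subtransversal is a subset of $U$ meeting each skew class at most once; a transversal is a subtransversal of size $|\Omega|$; a near-transversal is a subtransversal of size $|\Omega|-1$. $\mathcal S(\Omega)$ is the set of subtransversals. A multimatroid is a triple $Z=(U,\Omega,r)$ with $(U,\Omega)$ a carrier and $r:\mathcal S(\Omega)\to\mathbb Z_{\ge0}$ such that (R1) for each transversal $T$, the restriction of $r$ to subsets of $T$ is the rank function of a matroid on $T$; (R2) for each subtransversal $S$ and skew pair $\{e_i,e_j\}$ from a skew class disjoint from $S$, $r(S\cup\{e_i\})+r(S\cup\{e_j\})-2r(S)\ge 1$. $U(Z)$ denotes the ground set and $\mathcal T(Z)$ the set of transversals. The nullity of a subtransversal $S$ is $n(S)=|S|-r(S)$; $S$ is independent if $n(S)=0$; a basis is a maximal independent subtransversal. A multimatroid is determined by its carrier and its bases, via $r(S)=\max_B|B\cap S|$ over bases $B$. An element $u$ is singular if $r(\{u\})=0$; a skew class is singular if it contains a singular element. $Z$ is non-degenerate if every skew class has size at least two (then all bases are transversals). $Z$ is tight if it is non-degenerate and for every near-transversal $S$ there is a (necessarily unique) element $\theta_Z(S)$ in the skew class disjoint from $S$ with $r(S\cup\{\theta_Z(S)\})=r(S)$. Elementary minor: for $u$ in skew class $e$, $Z|u=(U-e,\Omega-\{e\},r')$ with $r'(S)=r(S\cup\{u\})-r(\{u\})$. $Z_1$ and $Z_2$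 align at a non-singular skew class $e$ if $U(Z_1)\cap U(Z_2)=e$ and $e$ is a non-singular skew class of both. If $Z_1,Z_2$ are tight multimatroids (with skew class sets $\Omega_1,\Omega_2$) aligning at a non-singular skew class $e$, the two-sum $Z_1\oplus_2 Z_2$ is the multimatroid with ground set $(U(Z_1)\cup U(Z_2))-e$, skew classes $(\Omega_1\cup\Omega_2)-\{e\}$, in which a transversal $B$ is a basis if and only if $B\cap U(Z_1)$ and $B\cap U(Z_2)$ are independent near-transversals of $Z_1$ and $Z_2$ respectively with $\theta_{Z_1}(B\cap U(Z_1))\ne\theta_{Z_2}(B\cap U(Z_2))$. Weighted transition polynomial: $Q(Z;\{x_u\}_{u\in U},t)=\sum_{T\in\mathcal T(Z)}t^{n(T)}\prod_{u\in T}x_u$, where the $x_u$ and $t$ are formal variables. The notation $Q(Z;\{x_u\},t\mid x_{e_i}=y_{e_i},\,i=1,\ldots,q)$ means that each variable $x_{e_i}$ is replaced by $y_{e_i}$ and all other variables are unaffected. *)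

(* Defs.v *)
(* Mathematical Components, with the multinomials library. *)
From mathcomp Require Import all_boot all_order all_algebra.
From mathcomp Require Export mpoly.

Set Implicit Arguments.
Unset Strict Implicit.
Unset Printing Implicit Defensive.

Import GRing.Theory.
Local Open Scope ring_scope.

(* Ground sets are subsets of an ambient finite type [E], so that two
   multimatroids may share elements. *)
Section Carriers.
Variable E : finType.

Record carrier := Carrier {
  ground : {set E};
  skew_classes : {set {set E}}
}.

Definition is_carrier (C : carrier) : bool :=
  partition (skew_classes C) (ground C).

Definition subtransversal (C : carrier) (S : {set E}) : bool :=
  (S \subset ground C) && [forall w in skew_classes C, #|S :&: w| <= 1]%N.

Definition transversal (C : carrier) (T : {set E}) : bool :=
  subtransversal C T && (#|T| == #|skew_classes C|).

(* Written with a successor to avoid truncated subtraction: a carrier without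
   skew classes has no near-transversal. *)
Definition near_transversal (C : carrier) (S : {set E}) : bool :=
  subtransversal C S && (#|S|.+1 == #|skew_classes C|).

End Carriers.

Section Multimatroids.
Variable E : finType.

(* The data (U, Omega, r).  The axioms are the predicate [multimatroid] below;
   [rank] is only meaningful on subtransversals. *)
Record mm_triple := MMTriple {
  mm_carrier :> carrier E;
  rank : {set E} -> nat
}.

Definition matroid_rank_on (T : {set E}) (r : {set E} -> nat) : Prop :=
  [/\ forall A : {set E}, A \subset T -> (r A <= #|A|)%N,
      forall A B : {set E}, A \subset B -> B \subset T -> (r A <= r B)%N
    & forall A B : {set E}, A \subset T -> B \subset T ->
        (r (A :|: B) + r (A :&: B) <= r A + r B)%N].

Definition multimatroid (Z : mm_triple) : Prop :=
  [/\ is_carrier Z,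
      forall T, transversal Z T -> matroid_rank_on T (rank Z)
    & forall (S w : {set E}) (u v : E),
        subtransversal Z S -> w \in skew_classes Z -> [disjoint w & S] ->
        u \in w -> v \in w -> u != v ->
        (rank Z S * 2 + 1 <= rank Z (u |: S) + rank Z (v |: S))%N].

Definition nullity (Z : mm_triple) (S : {set E}) : nat := (#|S| - rank Z S)%N.

Definition independent (Z : mm_triple) (S : {set E}) : bool :=
  subtransversal Z S && (nullity Z S == 0%N).

Definition singular (Z : mm_triple) (u : E) : bool :=
  (u \in ground Z) && (rank Z [set u] == 0%N).

Definition singular_class (Z : mm_triple) (w : {set E}) : bool :=
  (w \in skew_classes Z) && [exists u in w, singular Z u].

Definition nondegenerate (Z : mm_triple) : Prop :=
  forall w, w \in skew_classes Z -> (2 <= #|w|)%N.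

(* [u] has the defining property of theta_Z(S). *)
Definition is_theta (Z : mm_triple) (S : {set E}) (u : E) : bool :=
  [exists w in skew_classes Z, [disjoint w & S] && (u \in w)]
  && (rank Z (u |: S) == rank Z S).

Definition theta (Z : mm_triple) (S : {set E}) : option E :=
  [pick u | is_theta Z S u].

Definition tight (Z : mm_triple) : Prop :=
  nondegenerate Z /\
  forall S, near_transversal Z S -> exists u, is_theta Z S u.

Definition minor (Z : mm_triple) (u : E) : mm_triple :=
  let w := pblock (skew_classes Z) u in
  MMTriple (Carrier (ground Z :\: w) (skew_classes Z :\ w))
           (fun S => (rank Z (u |: S) - rank Z [set u])%N).

Definition align (Z1 Z2 : mm_triple) (e : {set E}) : Prop :=
  [/\ ground Z1 :&: ground Z2 = e,
      (e \in skew_classes Z1) && ~~ singular_class Z1 e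
    & (e \in skew_classes Z2) && ~~ singular_class Z2 e].

Definition two_sum_carrier (Z1 Z2 : mm_triple) (e : {set E}) : carrier E :=
  Carrier ((ground Z1 :|: ground Z2) :\: e)
          ((skew_classes Z1 :|: skew_classes Z2) :\ e).

(* For tight [Z1] and [Z2] both values of [theta] below are of the form
   [Some _]. *)
Definition two_sum_basis (Z1 Z2 : mm_triple) (e B : {set E}) : bool :=
  let B1 := B :&: ground Z1 in
  let B2 := B :&: ground Z2 in
  [&& transversal (two_sum_carrier Z1 Z2 e) B,
      near_transversal Z1 B1 && independent Z1 B1,
      near_transversal Z2 B2 && independent Z2 B2
    & theta Z1 B1 != theta Z2 B2].

(* The two-sum is given by its bases; its rank function is recovered from them
   by r(S) = max_B |B :&: S|. *)
Definition two_sum (Z1 Z2 : mm_triple) (e : {set E}) : mm_triple :=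
  MMTriple (two_sum_carrier Z1 Z2 e)
    (fun S => \max_(B : {set E} | two_sum_basis Z1 Z2 e B) #|B :&: S|)%N.

End Multimatroids.

(* The ring Z[t, {x_u}_{u in E}]: the index [None] stands for the variable t
   and [Some u] for x_u. *)
Notation wpoly E := {mpoly int[#|{: option E}|]}.

Section TransitionPolynomial.
Variable E : finType.

Definition tvar : wpoly E := 'X_(enum_rank (None : option E)).
Definition xvar (u : E) : wpoly E := 'X_(enum_rank (Some u)).

(* Membership in the subring Z[t, {x_u}_{u in V}]. *)
Definition in_vars (V : {set E}) (p : wpoly E) : Prop :=
  forall (m : 'X_{1..#|{: option E}|}) (u : E),
    m \in msupp p -> u \notin V -> m (enum_rank (Some u)) = 0%N.

(* Simultaneous substitution of [y u] for x_u, for all u in [e]; the other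
   variables are unaffected. *)
Definition subst_vars (e : {set E}) (y : E -> wpoly E) (p : wpoly E) : wpoly E :=
  p \mPo [tuple (if enum_val i is Some u
                 then (if u \in e then y u else xvar u) else tvar)
         | i < #|{: option E}|].

Definition Qpoly (Z : mm_triple E) : wpoly E :=
  \sum_(T : {set E} | transversal Z T)
    tvar ^+ nullity Z T * \prod_(u in T) xvar u.

(* [y] solves the linear system in the ring Z[t, {x_u}_{u in U(Z2) - e}];
   only the values of [y] on [e] matter. *)
Definition minor_system_solution (Z2 : mm_triple E) (e : {set E})
    (y : E -> wpoly E) : Prop :=
  (forall u, u \in e -> in_vars (ground Z2 :\: e) (y u)) /\
  (forall u, u \in e ->
     Qpoly (minor Z2 u) = tvar * y u + \sum_(v in e | v != u) y v).

End TransitionPolynomial.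

(* Main.v *)
(* For near-transversals T_1, T_2 avoiding e of Z_1 and Z_2, the nullity of
   T_1 :|: T_2 in the two-sum is n(T_1) + n(T_2) + [theta(T_1) = theta(T_2)],
   while that of u |: T_1 in Z_1 is n(T_1) + [theta(T_1) = u], and that of T_2
   in Z_2|u is n(T_2) + [theta(T_2) = u].  Hence y_u, the sum of t^n(T_2) x^T_2
   over the T_2 with theta(T_2) = u, solves the system and satisfies the formula.
   For the two-sum nullity, extend a basis of each T_i to an independent
   near-transversal B_i: it has the same theta as T_i.  When the two thetas
   agree, this must be done in u |: T_1 instead, with a basis containing
   u = theta(T_1), which costs one element of T_1 but changes theta. *)

From mathcomp Require Import all_boot all_order all_algebra.
From mathcomp Require Import zify.
Require Import Defs.

Set Implicit Arguments.
Unset Strict Implicit.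
Unset Printing Implicit Defensive.

(** * Matroid rank functions: closure, extension to a basis, independent subsets *)

Section MatroidRank.
Variables (E : finType) (S : {set E}) (r : {set E} -> nat).
Hypothesis rS : matroid_rank_on S r.

Lemma mrank_setU1 (A : {set E}) u :
  A \subset S -> u \in S -> (r (u |: A) <= (r A).+1)%N.
Proof.
case: rS => [r_card _ r_sub] AS uS.
have uS' : [set u] \subset S by rewrite sub1set.
have := r_sub _ _ uS' AS; have := r_card _ uS'; rewrite cards1; lia.
Qed.

(** Monotonicity of closure: in the submodular inequality for [u |: A] and [B], the union is
    [u |: B] and the intersection contains [A]. *)
Lemma mrank_spanW (A B : {set E}) u :
  A \subset B -> B \subset S -> u \in S -> r (u |: A) = r A -> r (u |: B) = r B.
Proof.
case: rS => [_ r_mono r_sub] AB BS uS ruA.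
have uAS : u |: A \subset S by rewrite subUset sub1set uS (subset_trans AB).
have uBS : u |: B \subset S by rewrite subUset sub1set uS.
have := r_sub _ _ uAS BS; rewrite -setUA (setUidPr AB) ruA.
have : (r A <= r ((u |: A) :&: B))%N.
  apply: r_mono; first by rewrite subsetI AB subsetUr.
  by apply: subset_trans BS; apply: subsetIr.
have := r_mono _ _ (subsetUr [set u] B) uBS; lia.
Qed.

(** Equal ranks give [A] and [B] the same closure: [r (u |: A)] is squeezed between [r A] and
    [r (u |: B) = r B = r A]. *)
Lemma mrank_spanS (A B : {set E}) u :
    A \subset B -> B \subset S -> u \in S -> r A = r B ->
  r (u |: B) = r B -> r (u |: A) = r A.
Proof.
case: rS => [_ r_mono _] AB BS uS rAB ruB.
have uBS : u |: B \subset S by rewrite subUset sub1set uS.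
have uAuB : u |: A \subset u |: B by apply: setUS.
have := r_mono _ _ uAuB uBS.
have := r_mono _ _ (subsetUr [set u] A) (subset_trans uAuB uBS); lia.
Qed.

(** The elements of [S] are added to [A] one at a time; by [mrank_spanW] each is still spanned by
    the larger set, so the rank never moves. *)
Lemma mrank_full (A : {set E}) :
  A \subset S -> {in S, forall u, r (u |: A) = r A} -> r S = r A.
Proof.
move=> AS rA.
suff: forall n (B : {set E}), (#|S :\: B| <= n)%N ->
    A \subset B -> B \subset S -> r B = r A -> r S = r A.
  by move/(_ _ A (leqnn _)); apply.
elim=> [|n IHn] B cB AB BS rB; have [SB|] := boolP (S \subset B).
- by rewrite -rB; congr r; apply/eqP; rewrite eqEsubset SB.
- by rewrite -setD_eq0 -cards_eq0 -leqn0 cB.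
- by rewrite -rB; congr r; apply/eqP; rewrite eqEsubset SB.
case/subsetPn=> u uS uB; apply: (IHn (u |: B)).
- rewrite setUC setDUr; move: cB; rewrite (cardsD1 u (S :\: B)) !inE uS uB.
  rewrite add1n ltnS; apply: leq_trans; apply: subset_leq_card.
  by apply/subsetP=> v; rewrite !inE => /andP[/andP[-> ->] /andP[-> _]].
- exact: subset_trans (subsetUr _ _).
- by rewrite subUset sub1set uS.
by rewrite -rB; apply: mrank_spanW AB BS uS (rA _ uS).
Qed.

(** Greedy extension: elements that raise the rank are added until every element of [S] is spanned,
    and then [mrank_full] applies. *)
Lemma mrank_extend (A : {set E}) : A \subset S -> r A = #|A| ->
  exists I : {set E}, [/\ A \subset I, I \subset S, r I = #|I| & #|I| = r S].
Proof.
move: {2}_.+1 (ltnSn #|S :\: A|) => n; elim: n A => // n IHn A cA AS rA.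
have [/forall_inP full|] := boolP [forall u in S, r (u |: A) == r A].
  exists A; split=> //; rewrite -rA; apply/esym/mrank_full => // u uS.
  exact/eqP/full.
case/forall_inPn=> u uS ruA.
have uA : u \notin A by apply: contra ruA => uA; rewrite (setUidPr _) // sub1set.
have uAS : u |: A \subset S by rewrite subUset sub1set uS.
have /= [|//||I [AI IS rI cI]] := IHn (u |: A).
- move: cA; rewrite (cardsD1 u (S :\: A)) !inE uS uA add1n ltnS.
  apply: leq_trans; rewrite ltnS; apply: subset_leq_card.
  by apply/subsetP=> v; rewrite !inE negb_or => /andP[/andP[-> ->] ->].
- rewrite cardsU1 uA -rA; move: ruA (mrank_setU1 AS uS).
  case: rS => [_ /(_ _ _ (subsetUr [set u] A) uAS) + _]; lia.
by exists I; split=> //; apply: subset_trans AI; apply: subsetUr.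
Qed.

Lemma mrank_indepS (A B : {set E}) :
  A \subset B -> B \subset S -> r B = #|B| -> r A = #|A|.
Proof.
case: rS => [r_card r_mono r_sub] AB BS rB.
have AS := subset_trans AB BS.
have DS : B :\: A \subset S by apply: subset_trans BS; apply: subsetDl.
have := r_sub _ _ AS DS; rewrite -{1}(setIidPr AB) setID.
have := r_card _ AS; have := r_card _ DS; have := cardsD B A.
rewrite (setIidPr AB); have := subset_leq_card AB; lia.
Qed.

End MatroidRank.

(** * Carriers: transversals, their extension, and decomposition along disjoint ground sets *)

Section CarrierTheory.
Variable E : finType.
Implicit Types (C : carrier E) (S T w : {set E}).

Lemma carrier_sub C w : is_carrier C -> w \in skew_classes C -> w \subset ground C.
Proof.
move=> /cover_partition <- wC; exact: bigcup_sup.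
Qed.

Lemma carrier_disjoint C w w' : is_carrier C ->
    w \in skew_classes C -> w' \in skew_classes C -> w != w' ->
  [disjoint w & w'].
Proof. by case/and3P=> _ /trivIsetP tI _; apply: tI. Qed.

Lemma carrier_neq0 C w : is_carrier C -> w \in skew_classes C -> w != set0.
Proof. by case/and3P=> _ _ /memPn; apply. Qed.

Lemma card_sum_classes C S : is_carrier C -> S \subset ground C ->
  #|S| = (\sum_(w in skew_classes C) #|S :&: w|)%N.
Proof.
case/and3P=> /eqP cov tI _ SC.
under eq_bigr => w _.
  rewrite setIC -sum1_card (eq_bigl (fun x => (x \in w) && (x \in S))); last first.
    by move=> x; rewrite inE.
  rewrite big_mkcondr; over.
rewrite -(big_trivIset _ (E := fun x => if x \in S then 1%N else 0%N) tI) cov.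
rewrite -big_mkcondr -sum1_card; apply: eq_bigl => x.
by have [/(subsetP SC) ->|] := boolP (x \in S); rewrite ?andbF.
Qed.

Lemma subtransversal_class C S w :
  subtransversal C S -> w \in skew_classes C -> (#|S :&: w| <= 1)%N.
Proof. by case/andP=> _ /forall_inP; apply. Qed.

Lemma subtransversalS C S T :
  S \subset T -> subtransversal C T -> subtransversal C S.
Proof.
move=> ST /andP[TC /forall_inP T1]; rewrite /subtransversal (subset_trans ST) //=.
apply/forall_inP=> w wC; apply: leq_trans (T1 w wC); apply: subset_leq_card.
exact: setSI.
Qed.

Lemma subtransversalU1 C S w u : is_carrier C -> subtransversal C S ->
  w \in skew_classes C -> [disjoint w & S] -> u \in w -> subtransversal C (u |: S).
Proof.
move=> cC sS wC wS uw; have wg := carrier_sub cC wC.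
rewrite /subtransversal subUset sub1set (subsetP wg) //=.
case/andP: (sS) => -> _ /=; apply/forall_inP=> w' w'C; rewrite setIUl.
have [<-|ww'] := eqVneq w w'.
  rewrite [S :&: w]setIC (disjoint_setI0 wS) setU0 -(cards1 u).
  by apply: subset_leq_card; apply: subsetIl.
have /disjoint_setI0 -> : [disjoint [set u] & w'].
  by rewrite disjoints1 (disjointFr (carrier_disjoint cC wC w'C ww')).
by rewrite set0U; apply: subtransversal_class sS w'C.
Qed.

(** A sum over the classes of terms at most one that reaches the number of classes has all its terms
    equal to one. *)
Lemma transversalP C T : is_carrier C ->
  reflect (T \subset ground C /\
           forall w, w \in skew_classes C -> #|T :&: w| = 1%N)
          (transversal C T).
Proof.
move=> cC; apply: (iffP andP) => [[sT]|[TC T1]].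
  have TC : T \subset ground C by case/andP: sT.
  rewrite (card_sum_classes cC TC) -sum1_card => sum1; split=> // w wC.
  have [_] := leqif_sum (fun w (wC : w \in skew_classes C) =>
                           leqif_eq (subtransversal_class sT wC)).
  by rewrite sum1 => /esym/forall_inP/(_ w wC)/eqP.
split; last first.
  by rewrite (card_sum_classes cC TC) -sum1_card; apply/eqP/eq_bigr.
by rewrite /subtransversal TC; apply/forall_inP=> w /T1 ->.
Qed.

Lemma transversal_sub C T : transversal C T -> T \subset ground C.
Proof. by case/andP=> /andP[]. Qed.

(** The predicate [P] is an invariant that can be kept while a missed class is filled. The trivial
    [P] completes a subtransversal, and independence as [P] completes an independent set to a
    basis. *)
Lemma extend_transversal C (P : pred {set E}) S : is_carrier C ->
    (forall T w, subtransversal C T -> P T -> w \in skew_classes C ->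
       [disjoint w & T] -> exists2 u, u \in w & P (u |: T)) ->
    subtransversal C S -> P S ->
  exists T, [/\ transversal C T, S \subset T & P T].
Proof.
move=> cC extP.
move: {2}_.+1 (ltnSn #|ground C :\: S|) => n; elim: n S => // n IHn S cS sS PS.
have SC : S \subset ground C by case/andP: sS.
have [/exists_inP[w wC wS]|] :=
    boolP [exists w in skew_classes C, [disjoint w & S]]; last first.
  move/exists_inPn=> meet; exists S; split=> //; apply/transversalP=> //.
  split=> // w wC; apply/eqP; rewrite eqn_leq (subtransversal_class sS wC) /=.
  by rewrite lt0n cards_eq0 setIC setI_eq0 meet.
have [u uw PuS] := extP _ _ sS PS wC wS.
have [||//|T [tT uST PT]] := IHn (u |: S).
- have uS : u \notin S by rewrite (disjointFr wS).
  have uC : u \in ground C by apply: (subsetP (carrier_sub cC wC)).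
  move: cS; rewrite (cardsD1 u (ground C :\: S)) !inE uS uC add1n ltnS.
  apply: leq_trans; rewrite ltnS; apply: subset_leq_card.
  by apply/subsetP=> v; rewrite !inE negb_or => /andP[/andP[-> ->] ->].
- exact: subtransversalU1 sS wC wS uw.
by exists T; split=> //; apply: subset_trans uST; apply: subsetUr.
Qed.

(* Its transversals are the near-transversals of [C] that are disjoint from
   [w]; see [near_transversal_remove]. *)
Definition remove_class C w : carrier E :=
  Carrier (ground C :\: w) (skew_classes C :\ w).

(** Meant for disjoint ground sets. Both the splitting of a carrier into one class and the rest, and
    the carrier of a two-sum, have this form, so one summation lemma serves both. *)
Definition join_carrier C C' : carrier E :=
  Carrier (ground C :|: ground C') (skew_classes C :|: skew_classes C').

Lemma is_carrier_class C w :
  is_carrier C -> w \in skew_classes C -> is_carrier (Carrier w [set w]).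
Proof.
move=> cC wC; apply/and3P; split => /=.
- by rewrite /cover big_set1.
- by apply/trivIsetP => A B; rewrite !inE => /eqP-> /eqP->; rewrite eqxx.
- by rewrite inE eq_sym (carrier_neq0 cC wC).
Qed.

Lemma is_carrier_remove C w :
  is_carrier C -> w \in skew_classes C -> is_carrier (remove_class C w).
Proof.
move=> cC wC; have/and3P[/eqP cov tI n0] := cC; apply/and3P; split => /=.
- rewrite eqEsubset; apply/andP; split.
    apply/bigcupsP=> w'; rewrite !inE => /andP[w'w w'C].
    by rewrite subsetD (carrier_sub cC w'C) (carrier_disjoint cC).
  apply/subsetP=> u; rewrite inE -cov => /andP[uw /bigcupP[w' w'C uw']].
  apply/bigcupP; exists w'; rewrite // !inE w'C andbT.
  by apply: contra uw => /eqP<-.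
- by apply: trivIsetS tI; apply: subsetDl.
- by rewrite inE negb_and n0 orbT.
Qed.

Lemma is_carrier_join C C' : is_carrier C -> is_carrier C' ->
  [disjoint ground C & ground C'] -> is_carrier (join_carrier C C').
Proof.
move=> /and3P[/eqP cov tI n0] /and3P[/eqP cov' tI' n0'] CC'.
apply/and3P; split => /=.
- by rewrite /cover bigcup_setU -/(cover _) -/(cover _) cov cov'.
- by apply: trivIsetU; rewrite ?cov ?cov'.
- by rewrite inE negb_or n0.
Qed.

Lemma transversal_join C C' T : is_carrier C -> is_carrier C' ->
    [disjoint ground C & ground C'] ->
  transversal (join_carrier C C') T =
  [&& T \subset ground C :|: ground C',
      transversal C (T :&: ground C) & transversal C' (T :&: ground C')].
Proof.
move=> cC cC' CC'; have cJ := is_carrier_join cC cC' CC'.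
have TI (D : carrier E) w : is_carrier D -> w \in skew_classes D ->
    T :&: ground D :&: w = T :&: w.
  by move=> cD wD; rewrite -setIA (setIidPr (carrier_sub cD wD)).
apply/(transversalP _ cJ)/and3P=> /= [[TJ T1]|[TJ T1 T1']].
  split=> //; apply/transversalP=> //; split; rewrite ?subsetIr // => w wC.
    by rewrite TI // T1 // inE wC.
  by rewrite TI // T1 // inE wC orbT.
split=> // w; rewrite inE => /orP[] wC.
  by rewrite -(TI C) //; case/(transversalP _ cC): T1 => _; apply.
by rewrite -(TI C') //; case/(transversalP _ cC'): T1' => _; apply.
Qed.

Lemma setU_separated C C' T T' : [disjoint ground C & ground C'] ->
    T \subset ground C -> T' \subset ground C' ->
  (T :|: T') :&: ground C = T /\ (T :|: T') :&: ground C' = T'.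
Proof.
move=> CC' TC TC'; rewrite !setIUl (setIidPl TC) (setIidPl TC').
have /disjoint_setI0-> : [disjoint T & ground C'] by apply: disjointWl CC'.
have /disjoint_setI0-> : [disjoint T' & ground C].
  by rewrite disjoint_sym; apply: disjointWr CC'.
by rewrite setU0 set0U.
Qed.

(** Union is a bijection from pairs of transversals to transversals of the join; its inverse
    intersects with the two ground sets. *)
Lemma big_transversal_join (R : nmodType) C C' (F : {set E} -> R) :
    is_carrier C -> is_carrier C' -> [disjoint ground C & ground C'] ->
  (\sum_(T | transversal (join_carrier C C') T) F T =
   \sum_(T | transversal C T) \sum_(T' | transversal C' T') F (T :|: T'))%R.
Proof.
move=> cC cC' CC'; rewrite pair_big /=.
rewrite (reindex_onto (fun p : {set E} * {set E} => p.1 :|: p.2)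
           (fun T => (T :&: ground C, T :&: ground C'))) /= => [|T]; last first.
  by rewrite transversal_join // => /and3P[TJ _ _]; rewrite -setIUr (setIidPl TJ).
apply: eq_bigl => -[T T'] /=; rewrite transversal_join //.
apply/andP/andP => [[/and3P[_ tT tT'] /eqP[eT eT']]|[tT tT']].
  by rewrite eT in tT; rewrite eT' in tT'.
have [-> ->] := setU_separated CC' (transversal_sub tT) (transversal_sub tT').
by rewrite eqxx tT tT' setUSS // transversal_sub.
Qed.

Lemma transversal_class w T :
  transversal (Carrier w [set w]) T -> exists2 u, u \in w & T = [set u].
Proof.
case/andP=> /andP[/= Tw _]; rewrite cards1 => /cards1P[u defT].
by exists u; rewrite // -sub1set -defT.
Qed.

Lemma big_transversal_class (R : nmodType) w (F : {set E} -> R) :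
  (\sum_(T | transversal (Carrier w [set w]) T) F T =
   \sum_(u in w) F [set u])%R.
Proof.
rewrite -(big_imset (h := set1) F) => [|u v _ _ /set1_inj//].
apply: eq_bigl => T; apply/idP/imsetP => [/transversal_class//|[u uw ->]].
rewrite /transversal /subtransversal /= sub1set uw !cards1 eqxx andbT.
apply/forall_inP=> _ /set1P->; rewrite -(cards1 u).
by apply: subset_leq_card; apply: subsetIl.
Qed.

(** Turns a sum over the transversals of [C] into a double sum over the elements of [w] and the
    near-transversals avoiding [w]. *)
Lemma join_remove_class C w : is_carrier C -> w \in skew_classes C ->
  C = join_carrier (Carrier w [set w]) (remove_class C w).
Proof.
move=> cC wC; have wg := carrier_sub cC wC.
rewrite /join_carrier /= setD1K // -{1}(setIidPr wg) setID.
by case: C {cC wC wg}.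
Qed.

Lemma disjoint_remove_class C w : [disjoint w & ground (remove_class C w)].
Proof. by rewrite disjoint_sym -setI_eq0 /= setIDAC setDIl setDv setI0. Qed.

Lemma subtransversal_remove C w S : is_carrier C -> w \in skew_classes C ->
  subtransversal (remove_class C w) S -> subtransversal C S.
Proof.
move=> cC wC /andP[]; rewrite /= subsetD => /andP[SC Sw] /forall_inP S1.
rewrite /subtransversal SC; apply/forall_inP=> w' w'C.
have [->|w'w] := eqVneq w' w; first by rewrite (disjoint_setI0 Sw) cards0.
by apply: S1; rewrite !inE w'w.
Qed.

Lemma near_transversal_remove C w S : is_carrier C -> w \in skew_classes C ->
  (near_transversal C S && [disjoint w & S]) = transversal (remove_class C w) S.
Proof.
move=> cC wC; rewrite /near_transversal /transversal /= (cardsD1 w (skew_classes C)).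
rewrite wC add1n eqSS andbAC; congr (_ && _).
apply/andP/idP => [[/andP[SC /forall_inP S1] wS]|sS].
  rewrite /subtransversal subsetD SC disjoint_sym wS.
  by apply/forall_inP=> w' /setD1P[_ /S1].
split; first exact: subtransversal_remove sS.
by move: sS; rewrite /subtransversal subsetD disjoint_sym => /andP[/andP[]].
Qed.

(** Identifies the class that [is_theta] only asserts to exist. *)
Lemma near_transversal_disjoint_class C w w' S : is_carrier C ->
    w \in skew_classes C -> transversal (remove_class C w) S ->
    w' \in skew_classes C -> [disjoint w' & S] -> w' = w.
Proof.
move=> cC wC tS w'C w'S; apply/eqP; apply: contraTT w'S => w'w.
case/(transversalP _ (is_carrier_remove cC wC)): tS => _ /(_ w').
rewrite !inE w'w w'C => /(_ isT) S1; rewrite disjoint_sym -setI_eq0 -cards_eq0.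
by rewrite S1.
Qed.

End CarrierTheory.

(** * Tight multimatroids: theta, nullities of near-transversals, and independent near-transversals
    with prescribed theta *)

Section TightMultimatroid.
Variables (E : finType) (Z : mm_triple E) (e : {set E}).
Hypothesis mmZ : multimatroid Z.
Implicit Types S T B w : {set E}.

Let cZ : is_carrier Z. Proof. by case: mmZ. Qed.

(** (R1) speaks of transversals; since classes are non-empty, [S] extends to one, and the rank
    axioms restrict to [S]. *)
Lemma mm_matroid S : subtransversal Z S -> matroid_rank_on S (rank Z).
Proof.
have cls T w : subtransversal Z T -> predT T -> w \in skew_classes Z ->
    [disjoint w & T] -> exists2 u, u \in w & predT (u |: T).
  by move=> _ _ /(carrier_neq0 cZ)/set0Pn[u uw] _; exists u.
move=> sS; have [T [tT ST _]] := extend_transversal cZ cls sS isT.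
case: mmZ => _ /(_ _ tT)[r_card r_mono r_sub] _; split.
- by move=> A AS; apply/r_card/(subset_trans AS).
- by move=> A B AB BS; apply: r_mono AB (subset_trans BS ST).
- by move=> A B AS BS; apply: r_sub (subset_trans AS ST) (subset_trans BS ST).
Qed.

Lemma mm_rank_le S : subtransversal Z S -> (rank Z S <= #|S|)%N.
Proof. by move/mm_matroid=> [r_card _ _]; apply: r_card. Qed.

Lemma independentE S :
  subtransversal Z S -> independent Z S = (rank Z S == #|S|).
Proof.
by move=> sS; have := mm_rank_le sS; rewrite /independent sS /nullity /=; lia.
Qed.

Lemma independentS S T : S \subset T -> independent Z T -> independent Z S.
Proof.
move=> ST iT; have sT : subtransversal Z T by case/andP: iT.
have sS := subtransversalS ST sT.
move: iT; rewrite !independentE // => /eqP rT; apply/eqP.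
by rewrite (mrank_indepS (mm_matroid sT) ST).
Qed.

Hypothesis tightZ : tight Z.

(** Non-degeneracy gives two elements [u], [v] of [w], and (R2) makes the ranks of [u |: S] and
    [v |: S] add up to at least [2 * #|S| + 1], so one of them is [#|S| + 1]. *)
Lemma independent_extend S w : independent Z S -> w \in skew_classes Z ->
  [disjoint w & S] -> exists2 u, u \in w & independent Z (u |: S).
Proof.
move=> iS wZ wS; have sS : subtransversal Z S by case/andP: iS.
have suS u : u \in w -> subtransversal Z (u |: S).
  exact: subtransversalU1 sS wZ wS.
have /card_gt1P[u [v [uw vw uv]]] : (1 < #|w|)%N by case: tightZ => + _; apply.
have card_U1 x : x \in w -> #|x |: S| = #|S|.+1.
  by move=> xw; rewrite cardsU1 (disjointFr wS).
case: mmZ => _ _ /(_ _ _ _ _ sS wZ wS uw vw uv).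
have := mm_rank_le (suS u uw); have := mm_rank_le (suS v vw).
move: iS; rewrite independentE // !card_U1 // => /eqP->.
have [ruS|] := eqVneq (rank Z (u |: S)) #|u |: S|.
  by exists u; rewrite // independentE ?suS // ruS.
rewrite card_U1 // => ruS rv ru rR.
by exists v; rewrite // independentE ?suS // card_U1 //; lia.
Qed.

Hypothesis eZ : e \in skew_classes Z.

Local Notation Ze := (remove_class Z e).

Lemma near_subtransversal T : transversal Ze T -> subtransversal Z T.
Proof. by case/andP=> /(subtransversal_remove cZ eZ). Qed.

Lemma near_disjoint T : transversal Ze T -> [disjoint e & T].
Proof. by rewrite -near_transversal_remove // => /andP[]. Qed.

Lemma near_subtransversalU1 T u :
  transversal Ze T -> u \in e -> subtransversal Z (u |: T).
Proof.
move=> tT; apply: subtransversalU1 (near_subtransversal tT) eZ _ => //.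
exact: near_disjoint.
Qed.

Lemma theta_near T :
  transversal Ze T -> exists2 u, u \in e & theta Z T = Some u.
Proof.
move=> tT; rewrite /theta; case: pickP => [u|no].
  case/andP=> /exists_inP[w wZ /andP[wT uw]] _; exists u => //.
  by rewrite -(near_transversal_disjoint_class cZ eZ tT wZ wT).
have [_ tight_ex] := tightZ.
by have [|u] := tight_ex T; rewrite ?no //; have := tT;
   rewrite -near_transversal_remove // => /andP[].
Qed.

(** Uniqueness of theta: two distinct elements of [e] that both leave the rank of [T] unchanged
    would violate (R2). *)
Lemma theta_rank T u : transversal Ze T -> u \in e ->
  (theta Z T == Some u) = (rank Z (u |: T) == rank Z T).
Proof.
move=> tT ue; have sT := near_subtransversal tT; have dT := near_disjoint tT.
have [v ve thT] := theta_near tT; rewrite thT.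
have rv : rank Z (v |: T) = rank Z T.
  by move: thT; rewrite /theta; case: pickP => // x /andP[_ /eqP rx] [<-].
apply/eqP/eqP=> [[<-]//|ru]; congr Some; apply/eqP/negPn/negP=> vu.
by case: mmZ => _ _ /(_ _ _ _ _ sT eZ dT ve ue vu); rewrite rv ru; lia.
Qed.

Lemma nullity_near T u : transversal Ze T -> u \in e ->
  nullity Z (u |: T) = (nullity Z T + (theta Z T == Some u))%N.
Proof.
move=> tT ue; have suT := near_subtransversalU1 tT ue.
have uT : u \in u |: T by rewrite setU11.
have TuT : T \subset u |: T by apply: subsetUr.
have := mrank_setU1 (mm_matroid suT) TuT uT.
have := mm_rank_le (near_subtransversal tT).
have [_ /(_ T _ TuT (subxx _)) r_mono _] := mm_matroid suT.
rewrite theta_rank // /nullity cardsU1 (disjointFr (near_disjoint tT) ue) /=.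
by have [->|] := eqVneq (rank Z (u |: T)) (rank Z T); lia.
Qed.

Lemma minor_carrier u : u \in e -> mm_carrier (minor Z u) = Ze.
Proof.
have /and3P[_ tI _] := cZ.
by move=> ue; rewrite /minor /= (def_pblock tI eZ ue).
Qed.

(** The set [B :&: T] is independent in [T]. If it has full rank there, it spans whatever [T] spans,
    in particular the theta of [T]; then [B] spans that element too, so the thetas agree. Distinct
    thetas therefore cost one. *)
Lemma independent_near_card B T : transversal Ze B -> transversal Ze T ->
  independent Z B -> (#|B :&: T| + (theta Z B != theta Z T) <= rank Z T)%N.
Proof.
move=> tB tT iB; have iA := independentS (subsetIl B T) iB.
have AT : B :&: T \subset T by apply: subsetIr.
have sA := subtransversalS AT (near_subtransversal tT).
have rA : rank Z (B :&: T) = #|B :&: T| by apply/eqP; rewrite -independentE.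
have [_ /(_ _ _ AT (subxx _)) + _] := mm_matroid (near_subtransversal tT).
have [u ue thT] := theta_near tT.
suff: rank Z (B :&: T) = rank Z T -> theta Z B = theta Z T.
  rewrite -rA; have [_ _ leA|ne thE leA] := eqVneq (theta Z B) (theta Z T).
    by rewrite addn0.
  by rewrite addn1 ltn_neqAle leA andbT; apply: contraNN ne => /eqP/thE->.
have uB : u \in u |: B by rewrite setU11.
have uT : u \in u |: T by rewrite setU11.
have ruT : rank Z (u |: T) = rank Z T.
  by apply/eqP; rewrite -theta_rank // thT.
move=> rAT; have ruA : rank Z (u |: B :&: T) = rank Z (B :&: T).
  have mT := mm_matroid (near_subtransversalU1 tT ue).
  exact (mrank_spanS mT AT (subsetUr _ _) uT rAT ruT).
have mB := mm_matroid (near_subtransversalU1 tB ue).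
have ruB := mrank_spanW mB (subsetIl B T) (subsetUr _ _) uB ruA.
by rewrite thT; apply/eqP; rewrite theta_rank // ruB.
Qed.

Lemma exists_near_same_theta T : transversal Ze T ->
  exists B, [/\ transversal Ze B, independent Z B,
                theta Z B = theta Z T & (rank Z T <= #|B :&: T|)%N].
Proof.
move=> tT; have sT := near_subtransversal tT; have mT := mm_matroid sT.
have r0 : rank Z set0 = #|(set0 : {set E})|.
  by case: mT => /(_ _ (sub0set T)); rewrite cards0; case: (rank Z _).
have [I [_ IT rI cI]] := mrank_extend mT (sub0set T) r0.
have sI := subtransversalS IT sT.
have iI : independent Z I by rewrite independentE // rI.
have sI' : subtransversal Ze I by apply: subtransversalS IT _; case/andP: tT.
(* The extension takes place in the carrier without [e], so that [B] is again a near-transversal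
   avoiding [e]. *)
have [|B [tB IB iB]] := extend_transversal (is_carrier_remove cZ eZ) _ sI' iI.
  by move=> S w _ iS /setD1P[_ wZ]; apply: independent_extend.
have le_r : (rank Z T <= #|B :&: T|)%N.
  by rewrite -cI; apply: subset_leq_card; rewrite subsetI IB.
exists B; split=> //.
(* [B] already meets [T] in at least [rank Z T] elements, which leaves no room for the extra one
   that distinct thetas would cost. *)
have := leq_trans (independent_near_card tB tT iB) le_r.
by rewrite -[leqRHS]addn0 leq_add2l leqn0 eqb0 negbK => /eqP.
Qed.

Hypothesis nse : ~~ singular_class Z e.

Lemma rank_nonsingular u : u \in e -> rank Z [set u] = 1%N.
Proof.
move=> ue; have ug : u \in ground Z by apply: (subsetP (carrier_sub cZ eZ)).
have s0 : subtransversal Z set0.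
  rewrite /subtransversal sub0set; apply/forall_inP=> w _.
  by rewrite set0I cards0.
have := subtransversalU1 cZ s0 eZ _ ue; rewrite setU0 => /(_ _)/mm_rank_le.
rewrite cards1 disjoint_sym -setI_eq0 set0I eqxx => /(_ isT).
move: nse; rewrite /singular_class eZ => /exists_inPn/(_ u ue).
by rewrite /singular ug; case: (rank Z [set u]) => [|[]].
Qed.

(** As [u] has rank one, removing it from [u |: T] and passing to the minor lowers size and rank by
    one each, so the nullity is that of [u |: T] in [Z]. *)
Lemma nullity_minor T u : transversal Ze T -> u \in e ->
  nullity (minor Z u) T = (nullity Z T + (theta Z T == Some u))%N.
Proof.
move=> tT ue; rewrite -nullity_near // /nullity /= rank_nonsingular //.
have suT := near_subtransversalU1 tT ue.
have [_ /(_ [set u] _ (subsetUl _ _) (subxx _)) + _] := mm_matroid suT.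
rewrite rank_nonsingular // cardsU1 (disjointFr (near_disjoint tT) ue) /=; lia.
Qed.

Lemma exists_near_other_theta T : transversal Ze T ->
  exists B, [/\ transversal Ze B, independent Z B,
                theta Z B != theta Z T & (rank Z T <= #|B :&: T|.+1)%N].
Proof.
move=> tT; have [u ue thT] := theta_near tT.
have suT := near_subtransversalU1 tT ue.
have uuT : [set u] \subset u |: T by rewrite sub1set setU11.
have ru : rank Z [set u] = #|[set u]| by rewrite rank_nonsingular // cards1.
have [I [uI IuT rI cI]] := mrank_extend (mm_matroid suT) uuT ru.
have sI := subtransversalS IuT suT.
have iI : independent Z I by rewrite independentE // rI.
have extI S w : subtransversal Z S -> independent Z S -> w \in skew_classes Z ->
    [disjoint w & S] -> exists2 v, v \in w & independent Z (v |: S).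
  by move=> _; apply: independent_extend.
have [J [tJ IJ iJ]] := extend_transversal cZ extI sI iI.
have uJ : u \in J by rewrite -sub1set (subset_trans uI).
(* The only element of [J] in [e] is [u], so [B] is [J] without [u]. Independence of [u |: B] then
   prevents [u] from being the theta of [B]. *)
pose B := J :&: ground Ze.
have tB : transversal Ze B.
  move: tJ; rewrite {1}(join_remove_class cZ eZ).
  rewrite (transversal_join _ (is_carrier_class cZ eZ) (is_carrier_remove cZ eZ)
             (disjoint_remove_class Z e)).
  by case/and3P.
have iuB : independent Z (u |: B).
  by apply: independentS iJ; rewrite subUset sub1set uJ subsetIl.
exists B; split=> //; first by apply: independentS iuB; apply: subsetUr.
  rewrite thT theta_rank //.
  have suB := near_subtransversalU1 tB ue.
  have := mm_rank_le (near_subtransversal tB).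
  move: iuB; rewrite independentE // => /eqP->.
  by rewrite cardsU1 (disjointFr (near_disjoint tB) ue) => rB; rewrite gtn_eqF.
(* Since [u] is the theta of [T], the set [I] has [rank Z T] elements; all of them except [u] lie in
   both [B] and [T]. *)
have := thT => /eqP; rewrite theta_rank // => /eqP <-; rewrite -cI.
rewrite (cardsD1 u I) -sub1set uI add1n ltnS; apply: subset_leq_card.
apply/subsetP=> v /setD1P[vu vI].
have vT : v \in T by move: (subsetP IuT v vI); rewrite !inE (negPf vu).
by rewrite !in_setI vT (subsetP IJ) // (subsetP (transversal_sub tT)).
Qed.

End TightMultimatroid.

(** * Bases, rank and nullity of the two-sum *)

Section TwoSum.
Variables (E : finType) (Z1 Z2 : mm_triple E) (e : {set E}).
Hypotheses (mmZ1 : multimatroid Z1) (mmZ2 : multimatroid Z2).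
Hypotheses (tightZ1 : tight Z1) (tightZ2 : tight Z2) (alignZ : align Z1 Z2 e).
Implicit Types T B : {set E}.

Local Notation C1 := (remove_class Z1 e).
Local Notation C2 := (remove_class Z2 e).

Let cZ1 : is_carrier Z1. Proof. by case: mmZ1. Qed.
Let cZ2 : is_carrier Z2. Proof. by case: mmZ2. Qed.
Let eZ1 : e \in skew_classes Z1. Proof. by case: alignZ => _ /andP[]. Qed.
Let eZ2 : e \in skew_classes Z2. Proof. by case: alignZ => _ _ /andP[]. Qed.
Let ns1 : ~~ singular_class Z1 e. Proof. by case: alignZ => _ /andP[]. Qed.
Let ns2 : ~~ singular_class Z2 e. Proof. by case: alignZ => _ _ /andP[]. Qed.

Lemma two_sum_carrierE : two_sum_carrier Z1 Z2 e = join_carrier C1 C2.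
Proof. by rewrite /two_sum_carrier /join_carrier /= !setDUl. Qed.

Lemma align_disjoint : [disjoint ground C1 & ground C2].
Proof.
by case: alignZ => gI _ _; rewrite -setI_eq0 /= -setDIl gI setDv.
Qed.

(** The bases of the two-sum are defined by intersecting with the full ground sets; these overlap
    only in [e], which [T1] and [T2] avoid. *)
Lemma align_ground T1 T2 :
    T1 \subset ground C1 -> T2 \subset ground C2 ->
  (T1 :|: T2) :&: ground Z1 = T1 /\ (T1 :|: T2) :&: ground Z2 = T2.
Proof.
case: alignZ => gI _ _; rewrite !subsetD => /andP[T1g T1e] /andP[T2g T2e].
rewrite !setIUl (setIidPl T1g) (setIidPl T2g).
have /eqP-> : T2 :&: ground Z1 == set0.
  by rewrite -{1}(setIidPl T2g) -setIA [ground Z2 :&: _]setIC gI setI_eq0.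
have /eqP-> : T1 :&: ground Z2 == set0.
  by rewrite -{1}(setIidPl T1g) -setIA gI setI_eq0.
by rewrite setU0 set0U.
Qed.

Lemma two_sum_transversalU T1 T2 : transversal C1 T1 -> transversal C2 T2 ->
  transversal (two_sum_carrier Z1 Z2 e) (T1 :|: T2).
Proof.
move=> tT1 tT2; have T1C := transversal_sub tT1; have T2C := transversal_sub tT2.
have := setU_separated align_disjoint T1C T2C.
rewrite two_sum_carrierE (transversal_join _ (is_carrier_remove cZ1 eZ1)
  (is_carrier_remove cZ2 eZ2) align_disjoint) => -[-> ->].
by rewrite tT1 tT2 setUSS.
Qed.

Lemma two_sum_basisU T1 T2 : transversal C1 T1 -> transversal C2 T2 ->
  two_sum_basis Z1 Z2 e (T1 :|: T2) =
  [&& independent Z1 T1, independent Z2 T2 & theta Z1 T1 != theta Z2 T2].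
Proof.
move=> tT1 tT2; rewrite /two_sum_basis.
have [-> ->] := align_ground (transversal_sub tT1) (transversal_sub tT2).
have := tT1; rewrite -(near_transversal_remove _ cZ1 eZ1) => /andP[-> _].
have := tT2; rewrite -(near_transversal_remove _ cZ2 eZ2) => /andP[-> _].
by rewrite two_sum_transversalU.
Qed.

Lemma two_sum_basis_split B : two_sum_basis Z1 Z2 e B ->
  exists T1 T2, [/\ transversal C1 T1, transversal C2 T2 & B = T1 :|: T2].
Proof.
case/and4P=> + _ _ _; rewrite two_sum_carrierE.
rewrite (transversal_join _ (is_carrier_remove cZ1 eZ1)
  (is_carrier_remove cZ2 eZ2) align_disjoint) => /and3P[BC tB1 tB2].
exists (B :&: ground C1), (B :&: ground C2); split=> //.
by rewrite -setIUr (setIidPl BC).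
Qed.

Lemma card_near_setU T1 T2 : T1 \subset ground C1 -> T2 \subset ground C2 ->
  #|T1 :|: T2| = (#|T1| + #|T2|)%N.
Proof.
move=> T1C T2C; rewrite cardsU disjoint_setI0 ?cards0 ?subn0 //.
exact: disjointWl T1C (disjointWr T2C align_disjoint).
Qed.

Lemma card_near_setI B1 B2 T1 T2 :
    B1 \subset ground C1 -> B2 \subset ground C2 ->
    T1 \subset ground C1 -> T2 \subset ground C2 ->
  #|(B1 :|: B2) :&: (T1 :|: T2)| = (#|B1 :&: T1| + #|B2 :&: T2|)%N.
Proof.
move=> B1C B2C T1C T2C; have [eB1 eB2] := setU_separated align_disjoint B1C B2C.
rewrite setIUr -{1}(setIidPr T1C) -{1}(setIidPr T2C) !setIA eB1 eB2.
by rewrite card_near_setU // subIset ?B1C ?B2C.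
Qed.

(** The indicator is added on the left to avoid truncated subtraction. The rank is a maximum over
    bases, so the proof is an upper bound for every basis and one basis that attains it. *)
Lemma two_sum_rank T1 T2 : transversal C1 T1 -> transversal C2 T2 ->
  (rank (two_sum Z1 Z2 e) (T1 :|: T2) + (theta Z1 T1 == theta Z2 T2) =
   rank Z1 T1 + rank Z2 T2)%N.
Proof.
move=> tT1 tT2.
have T1C := transversal_sub tT1; have T2C := transversal_sub tT2.
have upper B : two_sum_basis Z1 Z2 e B ->
    (#|B :&: (T1 :|: T2)| + (theta Z1 T1 == theta Z2 T2) <=
     rank Z1 T1 + rank Z2 T2)%N.
  move=> bB; have [B1 [B2 [tB1 tB2 defB]]] := two_sum_basis_split bB.
  move: bB; rewrite {}defB two_sum_basisU // => /and3P[iB1 iB2 thB].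
  rewrite card_near_setI // ?transversal_sub //.
  have le1 := independent_near_card mmZ1 tightZ1 eZ1 tB1 tT1 iB1.
  have le2 := independent_near_card mmZ2 tightZ2 eZ2 tB2 tT2 iB2.
  apply: leq_trans (leq_add le1 le2); rewrite addnACA leq_add2l.
  (* The two halves of a basis have different thetas, so if [T1] and [T2] share theirs, at least one
     half disagrees with it and loses one element. *)
  case: eqP => // th; move: thB; rewrite th.
  have [->|//] := eqVneq (theta Z1 B1) (theta Z2 T2).
  by move=> neB; rewrite [theta Z2 B2 == _]eq_sym neB.
have lower : exists2 B, two_sum_basis Z1 Z2 e B &
    (rank Z1 T1 + rank Z2 T2 <=
     #|B :&: (T1 :|: T2)| + (theta Z1 T1 == theta Z2 T2))%N.
  have [B2 [tB2 iB2 thB2 rB2]] :=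
    exists_near_same_theta mmZ2 tightZ2 eZ2 tT2.
  have [th|th] := eqVneq (theta Z1 T1) (theta Z2 T2).
    have [B1 [tB1 iB1 thB1 rB1]] :=
      exists_near_other_theta mmZ1 tightZ1 eZ1 ns1 tT1.
    exists (B1 :|: B2); first by rewrite two_sum_basisU // iB1 iB2 thB2 -th.
    by rewrite card_near_setI ?transversal_sub //= addn1 -addSn leq_add.
  have [B1 [tB1 iB1 thB1 rB1]] :=
    exists_near_same_theta mmZ1 tightZ1 eZ1 tT1.
  exists (B1 :|: B2); first by rewrite two_sum_basisU // iB1 iB2 thB1 thB2.
  by rewrite card_near_setI ?transversal_sub //= addn0 leq_add.
(* The maximum is attained only over a non-empty family of bases, and the basis from the lower bound
   also provides this. *)
have [B bB leB] := lower.
have bases : (0 < #|two_sum_basis Z1 Z2 e|)%N by apply/card_gt0P; exists B.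
have [B0 bB0 rT] := eq_bigmax_cond (fun B => #|B :&: (T1 :|: T2)|) bases.
apply/eqP; rewrite eqn_leq [rank _ _]rT upper //= -rT.
apply: leq_trans leB _; rewrite leq_add2r.
exact: (leq_bigmax_cond B bB).
Qed.

Lemma two_sum_nullity T1 T2 : transversal C1 T1 -> transversal C2 T2 ->
  nullity (two_sum Z1 Z2 e) (T1 :|: T2) =
  (nullity Z1 T1 + nullity Z2 T2 + (theta Z1 T1 == theta Z2 T2))%N.
Proof.
move=> tT1 tT2; have := two_sum_rank tT1 tT2.
have := mm_rank_le mmZ1 (near_subtransversal mmZ1 eZ1 tT1).
have := mm_rank_le mmZ2 (near_subtransversal mmZ2 eZ2 tT2).
rewrite /nullity card_near_setU ?transversal_sub //.
by move: (nat_of_bool _) => d; clear; lia.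
Qed.

End TwoSum.

(** * Polynomials: variables that occur, substitution, injectivity of the linear system *)

Section Polynomials.
Variable E : finType.
Implicit Types (V e S T : {set E}) (p q : wpoly E).
Local Open Scope ring_scope.
Import GRing.Theory.

Lemma in_varsX V (m : 'X_{1..#|{: option E}|}) :
  (forall u, u \notin V -> m (enum_rank (Some u)) = 0%N) -> in_vars V 'X_[m].
Proof. by move=> mV m' u /mem_msuppXP<-; apply: mV. Qed.

Lemma in_vars0 V : in_vars V 0.
Proof. by move=> m u; rewrite msupp0. Qed.

Lemma in_vars1 V : in_vars V 1.
Proof. by move=> m u; rewrite msupp1 inE => /eqP-> _; rewrite mnm0E. Qed.

Lemma in_varsD V p q : in_vars V p -> in_vars V q -> in_vars V (p + q).
Proof.
move=> pV qV m u /msuppD_le; rewrite mem_cat => /orP[]; [exact: pV|exact: qV].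
Qed.

Lemma in_varsM V p q : in_vars V p -> in_vars V q -> in_vars V (p * q).
Proof.
move=> pV qV m u /msuppM_le/allpairsP[[m1 m2] /= [m1p m2q ->]] uV.
by rewrite mnmDE (pV _ _ m1p uV) (qV _ _ m2q uV).
Qed.

Lemma in_vars_tvar V : in_vars V (tvar E).
Proof.
apply: in_varsX => u _; rewrite mnm1E; apply/eqP.
by rewrite eqb0 (inj_eq enum_rank_inj).
Qed.

Lemma in_vars_xvar V u : u \in V -> in_vars V (xvar u).
Proof.
move=> uV; apply: in_varsX => v vV; rewrite mnm1E; apply/eqP.
rewrite eqb0 (inj_eq enum_rank_inj); apply: contraNneq vV => -[<-].
exact: uV.
Qed.

(** A term of [Qpoly] with the exponent of t kept free of [T], so that it can be shifted by an
    indicator of theta and split along a disjoint union. *)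
Definition monomial (n : nat) T : wpoly E := tvar E ^+ n * \prod_(u in T) xvar u.

Lemma in_vars_monomial V n T : T \subset V -> in_vars V (monomial n T).
Proof.
move=> TV; apply: in_varsM.
  elim: n => [|n IHn]; first exact: in_vars1.
  by rewrite exprS; apply: in_varsM IHn; apply: in_vars_tvar.
apply: (big_ind (in_vars V)) => [|p q|u uT]; first exact: in_vars1.
  exact: in_varsM.
by apply: in_vars_xvar; apply: (subsetP TV).
Qed.

Lemma monomialU m n S T : [disjoint S & T] ->
  monomial (m + n) (S :|: T) = monomial m S * monomial n T.
Proof.
move=> dST; rewrite /monomial exprD mulrACA -bigU //.
by congr (_ * _); apply: eq_bigl => u; rewrite !inE.
Qed.

Lemma monomial_expS (k : bool) n T :
  monomial (n + k) T = tvar E ^+ k * monomial n T.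
Proof. by rewrite /monomial addnC exprD mulrA. Qed.

Section Substitution.
Variables (e : {set E}) (y : E -> wpoly E).

Lemma subst_vars_tvar : subst_vars e y (tvar E) = tvar E.
Proof.
by rewrite /subst_vars comp_mpolyXU -tnth_nth tnth_mktuple enum_rankK.
Qed.

Lemma subst_vars_xvar u :
  subst_vars e y (xvar u) = if u \in e then y u else xvar u.
Proof.
by rewrite /subst_vars comp_mpolyXU -tnth_nth tnth_mktuple enum_rankK.
Qed.

Lemma subst_vars_monomial n T : [disjoint e & T] ->
  subst_vars e y (monomial n T) = monomial n T.
Proof.
move=> eT; rewrite /subst_vars rmorphM rmorphXn rmorph_prod /=.
rewrite -/(subst_vars e y (tvar E)) subst_vars_tvar; congr (_ * _).
apply: eq_bigr => u uT; rewrite -/(subst_vars e y (xvar u)) subst_vars_xvar.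
by rewrite (disjointFl eT).
Qed.

Lemma subst_vars_monomialU1 n u T : u \in e -> [disjoint e & T] ->
  subst_vars e y (monomial n (u |: T)) = y u * monomial n T.
Proof.
move=> ue eT; rewrite /monomial big_setU1 ?(disjointFr eT) //= mulrCA.
rewrite /subst_vars rmorphM /= -/(subst_vars e y (xvar u)) subst_vars_xvar ue.
by congr (_ * _); apply: subst_vars_monomial.
Qed.

End Substitution.

(* Adding the rows gives [(t - 1 + #|e|) * \sum_(u in e) d u = 0]. *)
Lemma tvar_system_inj e (d : E -> wpoly E) :
    (forall u, u \in e -> tvar E * d u + \sum_(v in e | v != u) d v = 0) ->
  forall u, u \in e -> d u = 0.
Proof.
move=> sys; pose s := \sum_(u in e) d u.
(* At the point where all variables equal 2, this polynomial takes the value [n + 1]. *)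
have val_neq0 (n : nat) : tvar E - 1 + n%:R != 0.
  apply/eqP=> /(congr1 (meval (fun=> 2))).
  rewrite rmorphD rmorphB rmorph1 rmorph_nat rmorph0 /= mevalXU.
  by rewrite [_ - _](_ : _ = 1) // -[_ + _]mulrS natz.
have row u : u \in e -> (tvar E - 1) * d u + s = 0.
  move=> ue; rewrite -[RHS](sys u ue) /s (bigD1 u) //= mulrBl mul1r.
  by rewrite addrA subrK.
have /eqP : (tvar E - 1 + #|e|%:R) * s = 0.
  have: \sum_(u in e) ((tvar E - 1) * d u + s) = 0 by rewrite big1.
  by rewrite big_split /= -mulr_sumr sumr_const [(_ + #|e|%:R) * s]mulrDl mulr_natl.
rewrite mulf_eq0 (negPf (val_neq0 _)) /= => /eqP s0 u ue.
(* Once the total vanishes, each row reads [(tvar E - 1) * d u = 0]; the factor is the case [n = 0]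
   of [val_neq0]. *)
have /eqP := row u ue; rewrite s0 addr0 mulf_eq0 -[tvar E - 1]addr0.
by rewrite (negPf (val_neq0 0%N)) => /eqP.
Qed.

End Polynomials.

(** * Sums sorted by theta, the solution of the system, and the substituted polynomial *)

Section ThetaSums.
Variables (E : finType) (Z : mm_triple E) (e : {set E}).
Hypotheses (mmZ : multimatroid Z) (tightZ : tight Z).
Hypotheses (eZ : e \in skew_classes Z) (nse : ~~ singular_class Z e).
Local Open Scope ring_scope.
Import GRing.Theory.

Local Notation Ze := (remove_class Z e).

(** Each near-transversal avoiding [e] has exactly one theta, and it lies in [e]. *)
Lemma sum_theta (R : nmodType) (F : {set E} -> R) :
  \sum_(u in e) \sum_(T | transversal Ze T && (theta Z T == Some u)) F T =
  \sum_(T | transversal Ze T) F T.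
Proof.
under eq_bigr => u _ do rewrite big_mkcondr.
rewrite exchange_big /=; apply: eq_bigr => T tT.
have [u ue ->] := theta_near mmZ tightZ eZ tT.
rewrite (bigD1 u) //= eqxx big1 ?addr0 // => v /andP[_ vu].
by rewrite (inj_eq (@Some_inj _)) eq_sym (negPf vu).
Qed.

Definition theta_poly (u : E) : wpoly E :=
  \sum_(T | transversal Ze T && (theta Z T == Some u)) monomial (nullity Z T) T.

Lemma in_vars_theta_poly u : in_vars (ground Z :\: e) (theta_poly u).
Proof.
apply: (big_ind (in_vars _)) => [|p q|T /andP[tT _]]; first exact: in_vars0.
  exact: in_varsD.
by apply: in_vars_monomial; apply: transversal_sub tT.
Qed.

Lemma theta_poly_system u : u \in e ->
  Qpoly (minor Z u) = tvar E * theta_poly u + \sum_(v in e | v != u) theta_poly v.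
Proof.
(* One sum with coefficients [tvar E ^+ (v == u)] puts the right-hand side in the form of
   [sum_theta]: on the terms with theta [v], the exponent becomes the indicator that [nullity_minor]
   adds. *)
move=> ue; transitivity
    (\sum_(v in e) tvar E ^+ (v == u) * theta_poly v); last first.
  rewrite (bigD1 u) //= eqxx expr1; congr (_ + _); apply: eq_bigr => v.
  by case/andP=> _ /negPf->; rewrite expr0 mul1r.
under eq_bigr => v _.
  rewrite big_distrr /=.
  under eq_bigr => T /andP[_ /eqP thT].
    rewrite -monomial_expS -(inj_eq (@Some_inj _)) -thT; over.
  over.
rewrite sum_theta /Qpoly (minor_carrier mmZ eZ ue); apply: eq_bigr => T tT.
by rewrite (nullity_minor mmZ tightZ eZ).
Qed.

(** The difference of two solutions solves the homogeneous system, so [tvar_system_inj] applies. *)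
Lemma minor_system_unique (y y' : E -> wpoly E) :
    minor_system_solution Z e y -> minor_system_solution Z e y' ->
  {in e, y =1 y'}.
Proof.
case=> _ sys [_ sys'] u ue; apply/eqP; rewrite -subr_eq0; apply/eqP.
apply: (tvar_system_inj (d := fun v => y v - y' v)) ue => v ve.
rewrite mulrBr sumrB; apply/eqP.
by rewrite addrACA -opprD -sys // -sys' // subrr.
Qed.

(** A transversal of [Z] is some [u] in [e] together with a near-transversal avoiding [e], so each
    monomial has exactly one variable to replace. *)
Lemma subst_Qpoly (y : E -> wpoly E) :
  subst_vars e y (Qpoly Z) =
  \sum_(T | transversal Ze T) \sum_(u in e)
    y u * monomial (nullity Z T + (theta Z T == Some u)) T.
Proof.
have cZ : is_carrier Z by case: mmZ.
rewrite /Qpoly {1}(join_remove_class cZ eZ) big_transversal_join.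
- rewrite big_transversal_class exchange_big /= /subst_vars raddf_sum /=.
  apply: eq_bigr => T tT; rewrite raddf_sum /=; apply: eq_bigr => u ue.
  rewrite (nullity_near mmZ tightZ eZ) //.
  exact: (subst_vars_monomialU1 _ _ ue (near_disjoint mmZ eZ tT)).
- exact: is_carrier_class eZ.
- exact: is_carrier_remove.
exact: disjoint_remove_class.
Qed.

End ThetaSums.

Theorem theorem14 (E : finType) (Z1 Z2 : mm_triple E) (e : {set E})
    (mmZ1 : multimatroid Z1) (mmZ2 : multimatroid Z2)
    (tightZ1 : tight Z1) (tightZ2 : tight Z2) (alignZ : align Z1 Z2 e) :
  exists y : E -> wpoly E,
    [/\ minor_system_solution Z2 e y,
        forall y' : E -> wpoly E,
          minor_system_solution Z2 e y' -> {in e, y' =1 y}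
      & Qpoly (two_sum Z1 Z2 e) = subst_vars e y (Qpoly Z1)].
Proof.
have [_ /andP[eZ1 ns1] /andP[eZ2 ns2]] := alignZ.
have cZ1 : is_carrier Z1 by case: mmZ1.
have cZ2 : is_carrier Z2 by case: mmZ2.
have sol : minor_system_solution Z2 e (theta_poly Z2 e).
  split=> u ue; [exact: in_vars_theta_poly | exact: theta_poly_system].
exists (theta_poly Z2 e); split=> //.
  by move=> y' sol'; apply: minor_system_unique sol' sol.
rewrite subst_Qpoly // /Qpoly /= two_sum_carrierE.
rewrite (big_transversal_join _ (is_carrier_remove cZ1 eZ1)
  (is_carrier_remove cZ2 eZ2) (align_disjoint alignZ)).
apply: eq_bigr => T1 tT1.
(* For fixed [T1], the sum over [T2] is sorted by theta to match, for each [u], the summands of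
   [theta_poly Z2 e u]. *)
rewrite -(sum_theta mmZ2 tightZ2 eZ2); apply: eq_bigr => u ue.
rewrite big_distrl /=; apply: eq_bigr => T2 /andP[tT2 /eqP thT2].
have nT := two_sum_nullity mmZ1 mmZ2 tightZ1 tightZ2 alignZ tT1 tT2.
have dT : [disjoint T1 & T2].
  apply: disjointWl (transversal_sub tT1) _.
  exact: disjointWr (transversal_sub tT2) (align_disjoint alignZ).
(* As [T2] has theta [u], the indicator depends on [T1] and [u] alone; moved next to the nullity of
   [T1], it lets the monomial factor. *)
rewrite nT thT2 -/(monomial _ _) addnAC [RHS]GRing.mulrC.
exact: monomialU.
Qed.
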